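(* Let $(F_n)_{n\in\omega}$ be a sequence of nonempty finite subsets of $\omega$ such that $\lim_{n\to\infty}|F_n|=\infty$, and let $$\mathcal{I}(\mathscr{F}):=\left\{A\subseteq\omega : \frac{|A\cap F_n|}{|F_n|}\to 0 \text{ as } n\to\infty\right\}.$$ Then the set of bounded real sequences which are $\mathcal{I}(\mathscr{F})$-convergent to $0$ is not complemented in $\ell_\infty$.
   Context: $\omega$ denotes the set of nonnegative integers, and $\mathscr{F}=(F_n)$. $\ell_\infty$ is the Banach space of bounded real sequences $(x_n)_{n\in\omega}$ with the supremum norm. For an ideal $\mathcal{I}$ on $\omega$ (a collection of subsets of $\omega$ closed under subsets and finite unions, not containing $\omega$ and containing all finite sets), a real sequence $(x_n)_{n\in\omega}$ is $\mathcal{I}$-convergent to $0$ if $\{n\in\omega : |x_n|\ge\varepsilon\}\in\mathcal{I}$ for every $\varepsilon>0$. A closed subspace of a Banach space is complemented if it is the range of a bounded linear projection on that space. *)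

(* Defs.v *)
From HB Require Import structures.
From mathcomp Require Import all_boot all_order all_algebra finmap.
From mathcomp Require Import all_classical all_reals all_analysis.

Set Implicit Arguments.
Unset Strict Implicit.
Unset Printing Implicit Defensive.

Import Order.TTheory GRing.Theory Num.Theory.
Import numFieldNormedType.Exports.

Local Open Scope classical_set_scope.
Local Open Scope ring_scope.

Section EllInfty.
Variable R : realType.

Definition bounded_seq : {pred nat -> R} := [pred x | `[< bounded_fun x >]].

Lemma bounded_seqP (x : nat -> R) :
  reflect (exists M : R, forall n, `|x n| <= M) (x \in bounded_seq).
Proof.
apply: (iffP (asboolP _)) => [[M [_ xM]]|[M xM]].
  by exists (M + 1) => n; apply: xM => //; rewrite ltrDl.
exists M; split; first exact: num_real.
by move=> N MN n _; exact: le_trans (xM n) (ltW MN).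
Qed.

Fact bounded_seq_submod_closed : submod_closed bounded_seq.
Proof.
split=> [|a x y /bounded_seqP[M xM] /bounded_seqP[N yN]]; apply/bounded_seqP.
  by exists 0 => n; rewrite normr0.
exists (`|a| * M + N) => n.
by rewrite (le_trans (ler_normD _ _))// lerD// normrM ler_wpM2l.
Qed.

HB.instance Definition _ :=
  GRing.isSubmodClosed.Build R (nat -> R) bounded_seq bounded_seq_submod_closed.

Record ell_infty := EllInfty {
  ell_infty_val :> nat -> R;
  ell_infty_bounded : ell_infty_val \in bounded_seq }.

HB.instance Definition _ := [isSub for ell_infty_val].
HB.instance Definition _ := [Choice of ell_infty by <:].
HB.instance Definition _ := [SubChoice_isSubLmodule of ell_infty by <:].

Definition sup_norm (x : ell_infty) : R := sup (range (fun n => `|x n|)).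

Lemma sup_norm_ub (x : ell_infty) n : `|x n| <= sup_norm x.
Proof.
apply: ub_le_sup; last by exists n.
have /bounded_seqP[M xM] := ell_infty_bounded x.
by exists M => _ [m _ <-].
Qed.

Lemma sup_norm_le (x : ell_infty) M : (forall n, `|x n| <= M) -> sup_norm x <= M.
Proof.
move=> xM; apply: ge_sup; first by exists `|x 0%N|; exists 0%N.
by move=> _ [n _ <-].
Qed.

Fact ler_sup_normD x y : sup_norm (x + y) <= sup_norm x + sup_norm y.
Proof.
apply: sup_norm_le => n.
by rewrite (le_trans (ler_normD _ _))// lerD// sup_norm_ub.
Qed.

Fact sup_normZ a x : sup_norm (a *: x) = `|a| * sup_norm x.
Proof.
have le_normZ b y : sup_norm (b *: y) <= `|b| * sup_norm y.
  by apply: sup_norm_le => n; rewrite normrM ler_wpM2l// sup_norm_ub.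
apply/eqP; rewrite eq_le le_normZ/=.
have [->|a0] := eqVneq a 0.
  by rewrite normr0 mul0r (le_trans (normr_ge0 ((0 *: x : ell_infty) 0%N)))// sup_norm_ub.
rewrite -ler_pdivlMl ?normr_gt0// -normfV.
by rewrite -{1}(scalerK a0 x) le_normZ.
Qed.

Fact sup_norm0_eq0 x : sup_norm x = 0 -> x = 0.
Proof.
move=> x0; apply/val_inj/funext => n; apply/eqP.
by rewrite -normr_le0 -x0 sup_norm_ub.
Qed.

HB.instance Definition _ := Lmodule_isNormed.Build R ell_infty
  ler_sup_normD sup_normZ sup_norm0_eq0.

Lemma ell_infty_normE (x : ell_infty) : `|x| = sup (range (fun n => `|x n|)).
Proof. by []. Qed.

Fact ell_infty_complete (F : set_system ell_infty) :
  ProperFilter F -> cauchy F -> cvg F.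
Proof.
move=> FF /cauchyP Fc.
have Fb (e : R) : 0 < e ->
    exists x : ell_infty, F [set y : ell_infty | forall n, `|x n - y n| < e].
  move=> /Fc[x Fx]; exists x; apply: filterS Fx => y.
  rewrite -ball_normE /= => xy n.
  by apply: le_lt_trans xy; exact: (sup_norm_ub (x - y)).
pose p n (x : ell_infty) : R := x n.
have pcvg n : cvg (p n @ F).
  apply: cauchy_cvg; apply/cauchy_exP => e e0.
  have [x Fx] := Fb e e0; exists (x n).
  rewrite -[_ (ball _ _)]/(F [set y | ball (x n) e (y n)]).
  by apply: filterS Fx => y xy; rewrite -ball_normE /=; exact: xy.
pose l n : R := lim (p n @ F).
have l_le (e : R) (x : ell_infty) :
    F [set y : ell_infty | forall n, `|x n - y n| < e] ->
    forall n, `|x n - l n| <= e.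
  move=> Fx n; have pl : (fun y => `|x n - p n y|) @ F --> `|x n - l n|.
    by apply: cvg_norm; apply: cvgB; [exact: cvg_cst|exact: pcvg].
  have := cvgr_to_le pl; apply; apply: filterS Fx => y xy; exact/ltW/xy.
have lb : l \in bounded_seq.
  have [x /l_le xl] := Fb 1 ltr01.
  apply/bounded_seqP; exists (sup_norm x + 1) => n.
  rewrite -[l n](subKr (x n)) (le_trans (ler_normB _ _))// lerD//.
  exact: sup_norm_ub.
apply/cvg_ex; exists (EllInfty lb); apply/cvgrPdist_le => e e0.
have [x Fx] := Fb (e / 2) (divr_gt0 e0 (ltr0Sn R 1)).
apply: filterS (Fx) => y xy; apply: sup_norm_le => n.
rewrite -[(_ - y) n]/(l n - y n) (le_trans (ler_distD (x n) _ _))//.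
by rewrite [leRHS]splitr lerD// ?(ltW (xy n))// distrC l_le.
Qed.

HB.instance Definition _ :=
  Uniform_isComplete.Build ell_infty ell_infty_complete.

End EllInfty.

(* The range of a bounded linear projection is a closed subspace, so none of
   this has to be assumed of M. *)
Definition complemented (R : realType) (V : completeNormedModType R)
    (M : set V) : Prop :=
  exists P : {linear V -> V},
    [/\ bounded_fun_norm P, forall x, P (P x) = P x & range P = M].

Definition density_ideal (R : realType) (F : nat -> {fset nat}) : set (set nat) :=
  [set A | (#|` [fset k in F n | k \in A]%fset|%:R / #|` F n|%:R : R)
             @[n --> \oo] --> (0 : R)].

Definition ideal_cvg0 (R : realType) (I : set (set nat)) (x : nat -> R) : Prop :=
  forall e : R, 0 < e -> I [set n | e <= `|x n|].

(* Main.v *)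
Require Import Defs.
From mathcomp Require Import all_boot all_order all_algebra finmap.
From mathcomp Require Import all_classical all_reals all_analysis.
From mathcomp Require Import zify.

(** Write [c0(I)] for the bounded sequences that are [I]-convergent to 0, where
[I] is the density ideal.  The proof follows Whitley's argument that [c0] is not
complemented in [l_infty].

A projection [P] onto [c0(I)] would make [Q = id - P] a bounded operator whose
kernel is exactly [c0(I)]; in particular [Q] does not kill the indicator of a
set outside [I].  Now let [A a] be a family of sets whose pairwise intersections
lie in [I].  Finitely many of the [A a] become disjoint after removal of sets
of [I], which [Q] does not notice, so every signed sum of their indicators is,
as far as [Q] can tell, a sequence of norm at most 1.  Choosing the signs so
that the [n]-th coordinates add up, only boundedly many of the [Q \1_(A a)] can
have a large [n]-th coordinate ([finite_large_images]), whence [Q \1_(A a)] is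
nonzero for only countably many [a] ([countable_nonzero_images]).  So an
ideal that admits an uncountable family of this kind, all of whose members lie
outside the ideal, defines an uncomplemented subspace
([not_complemented_ideal_cvg0]).

For the density ideal such a family is obtained from a sequence of pairwise
disjoint finite blocks [G k], each filling at least half of some [F n] with
[n >= k] ([disjoint_blocks]).  The union of infinitely many blocks has upper
density at least 1/2 along [F], hence is not in the ideal, while a union of
finitely many blocks is finite, hence in the ideal.  It remains to take an
uncountable almost disjoint family of sets of block indices: the branches of the
infinite binary tree, whose nodes are coded by natural numbers. *)

Import Order.TTheory GRing.Theory Num.Theory.
Import numFieldNormedType.Exports.

Local Open Scope classical_set_scope.
Local Open Scope ring_scope.

Set Implicit Arguments.
Unset Strict Implicit.
Unset Printing Implicit Defensive.

(** * Ideals and the sequences converging to 0 along them *)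

Definition is_ideal (T : Type) (I : set (set T)) : Prop :=
  [/\ I set0, forall A B, A `<=` B -> I B -> I A & setU_closed I].

Lemma is_ideal_bigcup_fset (T : Type) (X : choiceType) (I : set (set T))
    (A : X -> set T) (S : {fset X}) :
  is_ideal I -> (forall a, a \in S -> I (A a)) ->
  I (\bigcup_(a in [set` S]) A a).
Proof.
move=> [I0 _ IU] IA; rewrite bigcup_fset big_seq.
by elim/big_ind: _ => // B C; exact: IU.
Qed.

Lemma bounded_indic (R : realType) (A : set nat) :
  (\1_A : nat -> R) \in @bounded_seq R.
Proof.
apply/bounded_seqP; exists 1 => n.
by rewrite indicE; case: (n \in A); rewrite ?normr1 ?normr0.
Qed.

Definition indic_seq (R : realType) (A : set nat) : ell_infty R :=
  EllInfty (bounded_indic R A).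

Lemma ideal_cvg0_support (R : realType) (I : set (set nat)) (x : nat -> R) :
  is_ideal I -> I [set n | x n != 0] -> ideal_cvg0 I x.
Proof.
move=> [_ Isub _] Ix e e0; apply: Isub Ix => n /= /(lt_le_trans e0).
by rewrite normr_gt0.
Qed.

Lemma ideal_cvg0_indic (R : realType) (I : set (set nat)) (A : set nat) :
  is_ideal I -> ideal_cvg0 I (indic_seq R A) -> I A.
Proof.
move=> [_ Isub _] /(_ 1 ltr01); apply: Isub => n An /=.
by rewrite indicE mem_set// normr1.
Qed.

Lemma ell_infty_sumE (R : realType) (X : Type) (r : seq X)
    (x : X -> ell_infty R) n :
  (\sum_(a <- r) x a) n = \sum_(a <- r) x a n.
Proof.
elim/big_rec2: _ => [//|a u v _ <-].
by [].
Qed.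

(** At each coordinate at most one summand is nonzero. *)
Lemma sum_disjoint_le1 (R : realType) (X : choiceType) (S : {fset X})
    (B : X -> set nat) (s : X -> R) :
  (forall a b k, a \in S -> b \in S -> B a k -> B b k -> a = b) ->
  (forall a, `|s a| <= 1) ->
  `|\sum_(a <- S) s a *: indic_seq R (B a)| <= 1.
Proof.
move=> Bdisj s1; apply: sup_norm_le => k.
rewrite (_ : _ k = \sum_(a <- S) s a * \1_(B a) k); last first.
  by rewrite ell_infty_sumE.
have [[a aS Bak]|noB] := pselect (exists2 a, a \in S & B a k).
  rewrite (big_fsetD1 a)//= big_seq big1 ?addr0.
    by rewrite indicE mem_set// mulr1.
  move=> b; rewrite !inE => /andP[/eqP ba bS].
  rewrite indicE memNset ?mulr0// => Bbk.
  by apply: ba; exact: Bdisj Bbk Bak.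
rewrite big_seq big1 ?normr0// => a aS.
by rewrite indicE memNset ?mulr0// => Bak; apply: noB; exists a.
Qed.

(** * Operators vanishing on the sequences converging to 0 along an ideal *)

(** If [N] of the indices [a] satisfied the bound, the signed sum of the
corresponding indicators would have an image of [n]-th coordinate at least
[N * d]; but this image is also that of a sequence of norm at most 1, so
[N * d] is at most the bound [C] of [T] on the unit ball. *)
Lemma finite_large_images (R : realType) (X : choiceType) (I : set (set nat))
    (A : X -> set nat) (T : {linear ell_infty R -> ell_infty R}) n (d : R) :
  is_ideal I -> (forall a b, a != b -> I (A a `&` A b)) ->
  bounded_fun_norm T ->
  (forall x : ell_infty R, ideal_cvg0 I x -> T x = 0) ->
  0 < d ->
  finite_set [set a | d <= `|T (indic_seq R (A a)) n|].
Proof.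
move=> idI AI /(_ 1)[C TC] T0 d0; apply: contrapT.
move=> /(infinite_set_fset (Num.truncn (C / d)).+1)[S SA cardS].
(* B a is A a made disjoint from the other members of S; only a set of I is
   lost, so T takes the same value on both indicators. *)
pose B a := A a `\` \bigcup_(b in [set` (S `\ a)%fset]) A b.
have TB a : T (indic_seq R (B a)) = T (indic_seq R (A a)).
  apply/eqP; rewrite eq_sym -subr_eq0 -linearB; apply/eqP/T0.
  apply: ideal_cvg0_support => //.
  have : I (\bigcup_(b in [set` (S `\ a)%fset]) (A a `&` A b)).
    apply: is_ideal_bigcup_fset => // b; rewrite !inE => /andP[ba _].
    by apply: AI; rewrite eq_sym.
  case: idI => _ + _; apply => k /=.
  rewrite -[(_ - _) k]/(\1_(A a) k - \1_(B a) k) !indicE => AB.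
  have [Aak|Aak] := pselect (A a k); last first.
    by move: AB; rewrite !memNset ?subrr ?eqxx// => -[].
  have [Bak|] := pselect (B a k).
    by move: AB; rewrite !mem_set ?subrr ?eqxx.
  by move=> /not_andP[//|/contrapT[b Sb Abk]]; exists b.
pose s a : R := Num.sg (T (indic_seq R (A a)) n).
pose y := \sum_(a <- S) s a *: indic_seq R (B a).
have y1 : `|y| <= 1.
  apply: sum_disjoint_le1 => [a b k aS bS [Aak _] [_ nk]|a].
    apply: contrapT => /eqP ab; apply: nk; exists a => //=.
    by rewrite !inE ab.
  by rewrite /s normr_sg; case: (_ != 0).
have TyE : T y n = \sum_(a <- S) `|T (indic_seq R (A a)) n|.
  rewrite linear_sum ell_infty_sumE.
  apply: eq_bigr => a _; rewrite linearZ TB.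
  by rewrite -[LHS]/(s a * _) -normrEsg.
have : d * #|` S|%:R <= C.
  apply: le_trans (TC _ y1); apply: le_trans (sup_norm_ub _ n).
  apply: le_trans (ler_norm _); rewrite TyE mulr_natr.
  have -> : d *+ #|` S| = \sum_(a <- S) d.
    by rewrite big_const_seq count_predT iter_addr_0.
  rewrite [leLHS]big_seq [leRHS]big_seq.
  by apply: ler_sum => a aS; exact: SA.
apply/negP; rewrite -ltNge mulrC -ltr_pdivrMr//.
apply: lt_le_trans (truncnS_gt _) _; by rewrite ler_nat.
Qed.

(** A nonzero image has some coordinate [n] of absolute value at least
[1/(k+1)], and each pair [(n, k)] accounts for finitely many indices only. *)
Lemma countable_nonzero_images (R : realType) (X : choiceType)
    (I : set (set nat)) (A : X -> set nat)
    (T : {linear ell_infty R -> ell_infty R}) :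
  is_ideal I -> (forall a b, a != b -> I (A a `&` A b)) ->
  bounded_fun_norm T ->
  (forall x : ell_infty R, ideal_cvg0 I x -> T x = 0) ->
  countable [set a | T (indic_seq R (A a)) != 0].
Proof.
move=> idI AI Tb T0.
pose L n k := [set a | k.+1%:R^-1 <= `|T (indic_seq R (A a)) n|].
apply: (@sub_countable _ _ _ (\bigcup_n \bigcup_k L n k)); last first.
  apply: bigcup_countable => // n _; apply: bigcup_countable => // k _.
  apply: finite_set_countable; apply: (finite_large_images n idI AI Tb T0).
  by rewrite invr_gt0 ltr0Sn.
apply: subset_card_le => a /= Ta.
have [n Tan] : exists n, T (indic_seq R (A a)) n != 0.
  apply: contrapT => /forallNP Ta0; case/eqP: Ta.
  apply/val_inj/funext => n; apply/eqP.
  by have /negP := Ta0 n; rewrite negbK.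
exists n => //.
exists (Num.truncn `|T (indic_seq R (A a)) n|^-1) => //.
rewrite /L /= -[leRHS]invrK lef_pV2 ?posrE ?invr_gt0 ?normr_gt0 ?ltr0Sn//.
by rewrite ltW// truncnS_gt.
Qed.

(** The general form of Whitley's argument, applied to [id - P] for a projection
[P]. *)
Lemma not_complemented_ideal_cvg0 (R : realType) (X : choiceType)
    (I : set (set nat)) (A : X -> set nat) :
  is_ideal I -> ~ countable [set: X] ->
  (forall a, ~ I (A a)) -> (forall a b, a != b -> I (A a `&` A b)) ->
  ~ complemented [set x : ell_infty R | ideal_cvg0 I x].
Proof.
move=> idI Xunc AnI AI [P [Pb PP rP]].
pose Q : {linear ell_infty R -> ell_infty R} := idfun \- P.
have Q0 (x : ell_infty R) : ideal_cvg0 I x -> Q x = 0.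
  move=> Ix; have : range P x by rewrite rP.
  by move=> [y _ <-]; rewrite /Q /= PP subrr.
have Qb : bounded_fun_norm Q.
  move=> r; have [C PC] := Pb r; exists (r + C) => x xr.
  by rewrite (le_trans (ler_normB _ _))// lerD// PC.
apply: Xunc; have := countable_nonzero_images idI AI Qb Q0.
congr (countable _); apply/seteqP; split => // a _ /=; apply/eqP.
rewrite /Q /= => /subr0_eq AP; apply: (AnI a).
apply: (@ideal_cvg0_indic R) => //.
have : range P (indic_seq R (A a)) by exists (indic_seq R (A a)).
by rewrite rP.
Qed.

(** * An uncountable almost disjoint family of branches *)

(** Cantor's diagonal argument. *)
Lemma uncountable_branches : ~ countable [set: nat -> bool].
Proof.
move=> /countable_injP[f /in2TT finj].
pose diag n := `[< exists2 b, f b = n & b n = false >].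
have : diag (f diag) = ~~ diag (f diag); last by case: (diag _).
apply/idP/idP => [/asboolP[b /finj->->]//|].
by move=> /negbTE dF; apply/asboolP; exists diag.
Qed.

(** The node at height [n] of the branch [b] in the binary tree of finite
boolean words, coded as a natural number so that it can index a block. *)
Definition branch_node (b : nat -> bool) (n : nat) : nat :=
  choice.pickle (mkseq b n).

Lemma branch_node_inj b : injective (branch_node b).
Proof.
move=> m n /(pcan_inj choice.pickleK)/(congr1 size).
by rewrite !size_mkseq.
Qed.

(** Almost disjointness of the branches: words of different lengths never
coincide, and the words of two branches that differ at [i] differ from length
[i + 1] on. *)
Lemma branch_node_separated (b c : nat -> bool) : b != c ->
  exists i, forall m n, branch_node b m = branch_node c n -> (m <= i)%N.
Proof.
move=> /eqP bc; have [i bci] : exists i, b i != c i.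
  apply: contrapT => /forallNP E; apply: bc; apply/funext => i.
  by apply/eqP; have /negP := E i; rewrite negbK.
exists i => m n /(pcan_inj choice.pickleK) E.
have mn : m = n by move/(congr1 size): E; rewrite !size_mkseq.
rewrite leqNgt; apply: contra bci => im; apply/eqP.
by rewrite -(nth_mkseq false b im) E nth_mkseq -?mn.
Qed.

(** * Disjoint blocks and the density ideal *)

(** Since the sizes of the [F n] tend to infinity, one can choose recursively an
index past [k] whose [F n] is at least twice as large as the union [U k] of the
sets chosen so far; removing [U k] from it leaves at least half of it. *)
Lemma disjoint_blocks (F : nat -> {fset nat}) :
  (#|` F n|)%N @[n --> \oo] --> \oo ->
  exists G : nat -> {fset nat},
    (forall k l x, x \in G k -> x \in G l -> k = l) /\
    (forall k, exists2 n, (k <= n)%N &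
      (G k `<=` F n)%fset /\ (#|` F n| <= 2 * #|` G k|)%N).
Proof.
move=> Foo.
have /choice[h hP] : forall p : {fset nat} * nat,
    exists n, (p.2 <= n)%N /\ (2 * #|` p.1| <= #|` F n|)%N.
  move=> [U k].
  have /cvgnyPge/(_ (2 * #|` U|)%N) FU := Foo.
  have [n [? ?]] := filter_ex (filterI (nbhs_infty_ge k) FU).
  by exists n.
pose U := fix U k := if k is j.+1 then (U j `|` F (h (U j, j)))%fset else fset0.
pose G k := (F (h (U k, k)) `\` U k)%fset.
have Umono j k : (j <= k)%N -> (U j `<=` U k)%fset.
  elim: k => [|k IH]; first by rewrite leqn0 => /eqP->.
  rewrite leq_eqVlt => /predU1P[->//|/IH]; move/fsubset_trans; apply.
  exact: fsubsetUl.
have Glt k l x : (k < l)%N -> x \in G k -> x \in G l -> False.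
  move=> kl; rewrite !inE => /andP[_ xF] /andP[/negP xU _]; apply: xU.
  by apply: (fsubsetP (Umono _ _ kl)); rewrite /= inE xF orbT.
exists G; split=> [k l x xk xl|k].
  by case: (ltngtP k l) => // kl; [have := Glt _ _ _ kl xk xl|
                                   have := Glt _ _ _ kl xl xk].
have [/= kh Uh] := hP (U k, k).
exists (h (U k, k)) => //; split; first exact: fsubsetDl.
have UF : (#|` F (h (U k, k)) `&` U k| <= #|` U k|)%fset%N.
  by apply: fsubset_leq_card; exact: fsubsetIr.
have half_left f u i : (i <= u -> 2 * u <= f -> f <= 2 * (f - i))%N by lia.
by rewrite cardfsD; exact: half_left UF Uh.
Qed.

(** The comparison through which all memberships in the density ideal are
proved. *)
Lemma density_ideal_le (R : realType) (F : nat -> {fset nat}) (A : set nat)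
    (c : nat -> R) :
  (forall n, #|` [fset k in F n | k \in A]%fset|%:R <= c n) ->
  c n / #|` F n|%:R @[n --> \oo] --> (0 : R) ->
  density_ideal R F A.
Proof.
move=> Ac; apply: squeeze_cvgr; last exact: cvg_cst.
by apply: nearW => n; rewrite divr_ge0//= ler_wpM2r.
Qed.

Lemma density_ideal_is_ideal (R : realType) (F : nat -> {fset nat}) :
  is_ideal (density_ideal R F).
Proof.
split=> [|A B AB IB|A B IA IB].
- apply: (@density_ideal_le _ _ _ (fun=> 0)) => [n|].
    rewrite (_ : [fset _ in _ | _]%fset = fset0) ?cardfs0//.
    by apply/fsetP => k; rewrite !inE /= in_set0 andbF.
  under eq_cvg do rewrite mul0r.
  exact: cvg_cst.
- apply: density_ideal_le IB => n; rewrite ler_nat fsubset_leq_card//.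
  apply/fsubsetP => k; rewrite !inE/= => /andP[->] /set_mem/AB kB.
  by rewrite mem_set.
- apply: (@density_ideal_le _ _ _ (fun n =>
    #|` [fset k in F n | k \in A]%fset|%:R +
    #|` [fset k in F n | k \in B]%fset|%:R)) => [n|].
    rewrite -natrD ler_nat.
    apply: (@leq_trans #|` ([fset k in F n | k \in A]
                       `|` [fset k in F n | k \in B])%fset|); last first.
      by rewrite cardfsU leq_subr.
    apply: fsubset_leq_card; apply/fsubsetP => k.
    by rewrite !inE/= in_setU -andb_orr.
  rewrite -[X in _ --> X]addr0; under eq_cvg do rewrite mulrDl.
  exact: cvgD.
Qed.

Lemma density_ideal_finite (R : realType) (F : nat -> {fset nat})
    (A : set nat) :
  (#|` F n|)%N @[n --> \oo] --> \oo -> finite_set A -> density_ideal R F A.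
Proof.
move=> Foo /finite_fsetP[S ->].
apply: (@density_ideal_le _ _ _ (fun=> #|` S|%:R)) => [n|].
  rewrite ler_nat fsubset_leq_card//.
  by apply/fsubsetP => k; rewrite !inE/= => /andP[_] /set_mem.
rewrite -[X in _ --> X](mulr0 #|` S|%:R); apply: cvgMl_tmp.
apply/gtr0_cvgV0; last exact/cvgrnyP.
have /cvgnyPge/(_ 1%N) := Foo; apply: filterS => n.
by rewrite ltr0n.
Qed.

Theorem corollary2p2 (R : realType) (F : nat -> {fset nat})
  (F_neq0 : forall n, F n != fset0)
  (F_card : (#|` F n|)%N @[n --> \oo] --> \oo) :
  ~ complemented [set x : ell_infty R | ideal_cvg0 (density_ideal R F) x].
Proof.
have [G [Gdisj GF]] := disjoint_blocks F_card.
pose A (b : nat -> bool) := \bigcup_n [set` G (branch_node b n)].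
apply: (@not_complemented_ideal_cvg0 _ (nat -> bool) _ A).
- exact: density_ideal_is_ideal.
- exact: uncountable_branches.
- move=> b /cvgr_lt/(_ 2^-1); rewrite invr_gt0 ltr0n => /(_ isT)[N _ AN].
  (* Node codes are unbounded along b, as they are pairwise distinct, so some
     block of A b lies in an F n with n past the threshold N. *)
  have [j Nj] : exists j, (N <= branch_node b j)%N.
    apply: contrapT => /forallNP small; apply: infinite_nat.
    apply: (@sub_finite_set _ _ (branch_node b @^-1` `I_N)).
      by move=> j _ /=; rewrite ltnNge; apply/negP/small.
    apply: finite_preimage => // ? ? _ _; exact: branch_node_inj.
  have [n kn [GFn Fn2]] := GF (branch_node b j).
  have := AN n (leq_trans Nj kn); apply/negP; rewrite -leNgt.
  rewrite ler_pdivlMr ?ltr0n ?cardfs_gt0// mulrC ler_pdivrMr ?ltr0n//.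
  rewrite -natrM ler_nat mulnC (leq_trans Fn2)// leq_mul2l/=.
  apply: fsubset_leq_card; apply/fsubsetP => x xG.
  by rewrite !inE/= (fsubsetP GFn)//= mem_set//; exists j.
- move=> b c /branch_node_separated[i bci].
  apply: density_ideal_finite => //.
  apply: (@sub_finite_set _ _
    (\bigcup_(m in `I_i.+1) [set` G (branch_node b m)])).
    move=> x [[m _ xm] [n _ xn]]; exists m => //=.
    by rewrite ltnS; apply: bci; exact: Gdisj xm xn.
  by apply: bigcup_finite => // m _; exact: finite_fset.
Qed.
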